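(* Let $n$ be a positive integer and let $n=p_1^{\alpha_1}\cdots p_k^{\alpha_k}$ be the decomposition of $n$ as a product of prime factors, with $p_1,\dots,p_k$ distinct primes and $\alpha_i\ge 1$. Then for every positive integer $r$ we have $$|L_1(\mathbb{Z}_n^r)|=\frac{1}{\varphi(n)}\,\prod_{i=1}^k\ \sum_{\substack{1\leq m_i\leq p_i^{\alpha_i}\\ p_i\nmid m_i}}\gcd(m_i-1,p_i^{\alpha_i})^r.$$
   Context: $\mathbb{Z}_n=\mathbb{Z}/n\mathbb{Z}$ denotes the cyclic group of order $n$ (written additively), and $\mathbb{Z}_n^r$ is the direct product of $r$ copies of $\mathbb{Z}_n$. $\varphi$ is Euler's totient function, and for a finite abelian group $G$, $|L_1(G)|$ is the number of cyclic subgroups of $G$ (including the trivial subgroup). The convention $\gcd(0,a)=a$ is used for positive integers $a$, and an empty product equals $1$. *)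

(* Defs.v *)
From mathcomp Require Import all_boot all_order all_algebra.
From mathcomp Require Import all_fingroup all_solvable.

Set Implicit Arguments.
Unset Strict Implicit.
Unset Printing Implicit Defensive.

(* The direct product of r copies of the cyclic group of order n, for n > 0.
   The factor is the group Zp n rather than the whole type 'Z_n: the type 'Z_1
   has two elements, whereas Zp 1 is the trivial group. *)
Definition Zn_power (n r : nat) : {group {dffun 'I_r -> 'Z_n}} :=
  setXn_group (fun _ : 'I_r => Zp_group n).

Definition cyclic_subgroups (gT : finGroupType) (G : {group gT}) :
    {set {group gT}} :=
  [set H in subgroups G | cyclic H].

(* Main.v *)
Require Import Defs.
From mathcomp Require Import all_boot all_order all_algebra.
From mathcomp Require Import all_fingroup all_solvable.

Set Implicit Arguments.
Unset Strict Implicit.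
Unset Printing Implicit Defensive.

(** The theorem is Burnside's orbit-counting formula for the units modulo n
acting on G = Zn^r by powers (multiples, in additive notation).

A unit m sends x to x^m, and the orbit of x is the set of all generators of
<x>: the generators of <x> are the powers x^m with m coprime to the order d of
x, and since d divides n each such m can be replaced by a representative that
is coprime to n ([coprime_lift]).  Orbits on G thus correspond to cyclic
subgroups of G ([sum_fixed_powers], valid in any finite group whose exponent
divides n), and Burnside's formula gives
<<
  phi(n) |L_1(G)| = sum over units m modulo n of |{x in G : x^m = x}|.
>>
An element of Zn^r is fixed by m exactly when each of its r coordinates is
killed by m - 1, and Zn has gcd(m - 1, n) such elements; so the right-hand
side is the sum of gcd(m - 1, n)^r over the units m ([card_fixed_powers]).

By the Chinese remainder theorem this sum is multiplicative in n
([unit_gcd_sumM]), since m is a unit modulo ab exactly when it is one modulo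
both a and b, and gcd(m - 1, ab) = gcd(m - 1, a) gcd(m - 1, b) for coprime a
and b.  Splitting n into its prime powers p^a, modulo which the units are the
residues not divisible by p, turns the sum into the stated product. *)

(** * Arithmetic preliminaries *)

Lemma gcdn_coprimeMr k a b :
  coprime a b -> gcdn k (a * b) = gcdn k a * gcdn k b.
Proof.
move=> co_ab; apply/eqP; rewrite eqn_dvd; apply/andP; split.
  have -> : gcdn k a * gcdn k b = gcdn (gcdn (k * k) (k * b)) (a * gcdn k b).
    by rewrite muln_gcdl [k * gcdn k b]muln_gcdr.
  rewrite muln_gcdr !dvdn_gcd !(dvdn_mulr _ (dvdn_gcdl _ _)) !dvdn_gcdr.
  by rewrite (dvdn_trans (dvdn_gcdl _ _) (dvdn_mull _ _)).
rewrite Gauss_dvd ?dvdn_gcd ?dvdn_gcdl ?(dvdn_mulr _ (dvdn_gcdr _ _)) //.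
  by rewrite (dvdn_mull _ (dvdn_gcdr _ _)).
by rewrite (coprime_dvdl (dvdn_gcdr _ _)) // (coprime_dvdr (dvdn_gcdr _ _)).
Qed.

(** The reduction of units modulo n to units modulo d is onto: it is enough to
keep m modulo the part of n supported on the primes of d, and to take 1 modulo
the complementary part. *)
Lemma coprime_lift d n m : 0 < n -> d %| n -> coprime d m ->
  exists2 m', coprime n m' & m' = m %[mod d].
Proof.
move=> n_gt0 dvd_dn co_dm; have d_gt0 := dvdn_gt0 n_gt0 dvd_dn.
pose a := n`_\pi(d); pose b := n`_\pi(d)^'.
have co_ab : coprime a b by apply: coprime_partC.
exists (chinese a b m 1).
  rewrite -[n](partnC \pi(d) n_gt0) coprimeMl -/a -/b.
  rewrite -(coprime_modr a) chinese_modl // coprime_modr.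
  rewrite -(coprime_modr b) chinese_modr // coprime_modr coprimen1 andbT.
  (* [coprime_pi'] needs m > 0; for m = 0, coprimality forces d = 1. *)
  have [m0|m_gt0] := posnP m; last first.
    move: co_dm; rewrite coprime_pi' // => /(pnat_coprime _); apply.
    exact: part_pnat.
  move: co_dm; rewrite /a m0 /coprime gcdn0 => /eqP->.
  by rewrite gcdn0 part_p'nat // -coprime_pi' ?coprime1n.
have dvd_da : d %| a.
  by rewrite -(part_pnat_id (pnat_pi d_gt0)) partn_dvd.
by rewrite -(modn_dvdm _ dvd_da) chinese_modl // modn_dvdm.
Qed.

(** * Orbits of the power action and cyclic subgroups *)

Section Burnside.

Variables (gT : finGroupType) (G : {group gT}) (n : nat).
Hypotheses (n_gt0 : 0 < n) (expG : exponent G %| n).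

(* The elements of 'Z_n are residues modulo [(Zp_trunc n).+2], which is n for
   n > 1 but 2 for n = 1. *)
Let dvd_order_mod x : x \in G -> #[x]%g %| (Zp_trunc n).+2.
Proof.
move=> Gx; have := dvdn_trans (dvdn_exponent Gx) expG.
by case: n n_gt0 => [|[|k]] // _; rewrite dvdn1 => /eqP->.
Qed.

(** Elements outside G are left fixed because x^m depends on m modulo n only
when the order of x divides n; this makes the action total. *)
Definition unit_power (x : gT) (u : {unit 'Z_n}) : gT :=
  if x \in G then (x ^+ (val u : 'Z_n))%g else x.

Lemma unit_power_is_action : is_action [set: {unit 'Z_n}] unit_power.
Proof.
apply: is_total_action => [x | x u v]; rewrite /unit_power.
  by case: ifP => // _; rewrite expg1.
case: ifP => [Gx|->] //; rewrite groupX // -expgM FinRing.val_unitM /=.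
by apply/eqP; rewrite eq_expg_mod_order modn_dvdm // dvd_order_mod.
Qed.

Canonical unit_power_action := Action unit_power_is_action.

(** Two elements of G are conjugate under the units modulo n exactly when they
generate the same subgroup; surjectivity of the reduction of units to the order
of x is what makes every generator of <x> reachable. *)
Lemma orbit_unit_power x : x \in G ->
  orbit unit_power_action (units_Zp n) x = [set y | generator <[x]>%g y].
Proof.
move=> Gx; apply/setP=> y; rewrite inE; apply/orbitP/idP => [[u _ <-]|].
  rewrite /= /unit_power Gx generator_coprime.
  exact: coprime_dvdl (dvd_order_mod Gx) (valP u).
move=> gen_y; have [m def_y] := cycleP _ _ (cycle_generator gen_y).
rewrite def_y generator_coprime in gen_y.
have [m' co_m' eq_m] := coprime_lift (ltn0Sn _) (dvd_order_mod Gx) gen_y.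
have Um' : (m'%:R : 'Z_n)%R \is a GRing.unit.
  by rewrite Zp_nat unfold_in /= coprime_modr.
exists (FinRing.unit _ Um'); first by rewrite inE.
rewrite /= /unit_power Gx def_y SubK Zp_nat /=.
by apply/eqP; rewrite eq_expg_mod_order modn_dvdm ?eq_m // dvd_order_mod.
Qed.

(** Burnside's formula for the power action: a cyclic subgroup is determined by
its set of generators, and these sets are the orbits. *)
Lemma sum_fixed_powers :
  \sum_(u in units_Zp n) #|[set x in G | x ^+ (val u : 'Z_n) == x]%g|
    = #|cyclic_subgroups G| * totient n.
Proof.
have actsG : [acts units_Zp n, on G | unit_power_action].
  apply/actsP=> u _ x /=; rewrite /unit_power.
  by case: ifP => // Gx; rewrite groupX.
rewrite -card_units_Zp //.
transitivity (#|orbit unit_power_action (units_Zp n) @: G| * #|units_Zp n|).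
  rewrite -(Frobenius_Cauchy actsG); apply: eq_bigr => u _; apply: eq_card => x.
  rewrite inE in_setI; case: (boolP (x \in G)) => //= Gx.
  by apply/eqP/afix1P; rewrite /= /unit_power Gx.
congr (_ * _); pose gens (H : {group gT}) := [set y | generator H y].
have gens_inj : {in cyclic_subgroups G &, injective gens}.
  move=> H K; rewrite !inE => /andP[_ /cyclicP[x defH]] _ /setP/(_ x).
  rewrite !inE /generator -defH eqxx => /esym/eqP eqK.
  exact/val_inj.
rewrite -(card_in_imset gens_inj); apply: eq_card => O.
apply/imsetP/imsetP => [[x Gx ->]|[H]].
  exists <[x]>%G; last by rewrite orbit_unit_power.
  by rewrite !inE cycle_subG Gx cycle_cyclic.
rewrite !inE => /andP[sHG /cyclicP[x defH]] ->.
exists x; first by rewrite -cycle_subG -defH.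
by rewrite orbit_unit_power -?defH // -cycle_subG -defH.
Qed.

End Burnside.

(** * Fixed points of the power action on Zn^r *)

(** The k-torsion is the kernel of the k-th power map, whose image <a^k> has
order #[a] / gcd(#[a], k). *)
Lemma card_cycle_torsion (gT : finGroupType) (a : gT) k :
  #|[set x in <[a]> | x ^+ k == 1]%g| = gcdn k #[a]%g.
Proof.
have -> : [set x in <[a]> | x ^+ k == 1]%g = ('ker (cyclem k a))%g.
  by apply/setP=> x; rewrite !inE.
have /eqP := card_morphim (cyclem_morphism a k) <[a]>.
rewrite setIid morphim_cycle ?cycle_id // [#|_|]orderXgcd.
rewrite -(eqn_pmul2r (cardG_gt0 ('ker (cyclem k a))%G)).
rewrite [_ * _ in X in _ == X]mulnC.
rewrite Lagrange ?subsetIl // -[X in _ == X](divnK (dvdn_gcdl _ k)) eqn_pmul2l.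
  by move/eqP->; rewrite gcdnC.
by rewrite divn_gt0 ?gcdn_gt0 ?order_gt0 // dvdn_leq ?dvdn_gcdl ?order_gt0.
Qed.

Lemma dffun_expgE (I : finType) (gT : I -> finGroupType)
    (x : {dffun forall i, gT i}) m i : (x ^+ m)%g i = (x i ^+ m)%g.
Proof. by elim: m => [|m IHm]; rewrite ?expg0 ?expgS ffunE ?IHm. Qed.

Lemma exponent_Zn_power n r : 0 < n -> exponent (Zn_power n r) %| n.
Proof.
move=> n_gt0; apply/exponentP=> x /setXnP Zx; apply/ffunP=> i.
rewrite dffun_expgE ffunE; apply/eqP; rewrite -order_dvdn.
by rewrite -[n in X in _ %| X](card_Zp n_gt0) order_dvdG.
Qed.

Lemma card_fixed_powers n r m : 0 < n -> 0 < m ->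
  #|[set x in Zn_power n r | x ^+ m == x]%g| = gcdn (m - 1) n ^ r.
Proof.
case: m => // m n_gt0 _; rewrite subn1 /=.
have -> : [set x in Zn_power n r | x ^+ m.+1 == x]%g =
    setXn (fun _ : 'I_r => [set a in Zp n | a ^+ m == 1]%g).
  apply/setP=> x; rewrite inE [x \in _]in_setXn in_setXn.
  rewrite expgS -[X in _ == X]mulg1 (inj_eq (mulgI x)).
  apply/andP/forallP => [[/forallP Ax /eqP xm1] i | Ax].
    by rewrite inE Ax -(dffun_expgE x) xm1 ffunE.
  split; first by apply/forallP=> i; have := Ax i; rewrite inE => /andP[].
  apply/eqP/ffunP => i; have := Ax i; rewrite inE => /andP[_ /eqP].
  by rewrite dffun_expgE ffunE.
rewrite cardsXn prod_nat_const card_ord.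
have [a defZ] : exists a : 'Z_n, Zp n = <[a]>%g.
  rewrite /Zp; case: ifP => _; last by exists 1%g; rewrite cycle1.
  by exists Zp1; rewrite -Zp_cycle.
by rewrite defZ card_cycle_torsion orderE -defZ card_Zp.
Qed.

(** * The gcd sum over units as a multiplicative function *)

(** The residues are taken in 0, ..., n - 1, the range adapted to the Chinese
remainder theorem.  The residue 0 is a unit only for n = 1, where the truncated
difference 0 - 1 is harmless because the gcd is 1 anyway. *)
Definition unit_gcd_sum r n := \sum_(m < n | coprime n m) gcdn (m - 1) n ^ r.

(** Coprimality matters because of truncated subtraction: it ensures that m and
its residue are positive, unless q = 1 and both gcds are 1, or q = 0 and the
residue is m itself. *)
Lemma coprime_mod_pred q m :
  coprime q m -> gcdn (m %% q - 1) q = gcdn (m - 1) q.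
Proof.
case: q => [|[|q]] co; rewrite ?modn0 ?gcdn1 //.
have mq_gt0 : 0 < m %% q.+2.
  by case: (posnP (m %% q.+2)) co => // m0; rewrite -coprime_modr m0.
rewrite [in RHS](divn_eq m q.+2) -addnBA // gcdnC [RHS]gcdnC.
by rewrite gcdnMDl.
Qed.

Lemma unit_gcd_sumM r a b : 0 < a -> 0 < b -> coprime a b ->
  unit_gcd_sum r (a * b) = unit_gcd_sum r a * unit_gcd_sum r b.
Proof.
move=> a_gt0 b_gt0 co_ab.
rewrite /unit_gcd_sum big_distrlr /= pair_big /=.
pose h (i : 'I_(a * b)) : 'I_a * 'I_b :=
  (Ordinal (ltn_pmod i a_gt0), Ordinal (ltn_pmod i b_gt0)).
have h_bij : bijective h.
  apply: inj_card_bij; last by rewrite card_prod !card_ord.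
  move=> i j [eqa eqb]; apply: val_inj => /=.
  rewrite -(modn_small (ltn_ord i)) -(modn_small (ltn_ord j)).
  by apply/eqP; rewrite chinese_remainder // eqa eqb !eqxx.
rewrite (reindex h) /=; last exact: onW_bij.
apply: eq_big => [i | i]; first by rewrite !coprime_modr coprimeMl.
rewrite coprimeMl => /andP[co_a co_b].
by rewrite !coprime_mod_pred // gcdn_coprimeMr // expnMn.
Qed.

Lemma unit_gcd_sum1 r : unit_gcd_sum r 1 = 1.
Proof. by rewrite /unit_gcd_sum big_mkcond big_ord1 /= exp1n. Qed.

Lemma unit_gcd_sum_prod r (I : finType) (q : I -> nat) :
  (forall i, 0 < q i) -> (forall i j, i != j -> coprime (q i) (q j)) ->
  unit_gcd_sum r (\prod_i q i) = \prod_i unit_gcd_sum r (q i).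
Proof.
move=> q_gt0 co_q; elim: (index_enum I) (index_enum_uniq I) => [|i s IHs].
  by rewrite !big_nil unit_gcd_sum1.
move=> /= /andP[i_s uniq_s]; rewrite !big_cons unit_gcd_sumM ?IHs //.
  exact: prodn_gt0.
rewrite big_seq; apply: (big_ind (coprime (q i))) => [|x y cx cy|j js].
- exact: coprimen1.
- by rewrite coprimeMr cx.
by apply: co_q; apply: contraNneq i_s => ->.
Qed.

(** Passes between residues and the unit group on which Burnside's formula is
stated.  The case n = 1 is separate because 'Z_1 is the ring of integers modulo
2: its only unit is 1, whereas the sum has the residue 0 as its only index. *)
Lemma unit_gcd_sum_units r n : 0 < n ->
  unit_gcd_sum r n = \sum_(u in units_Zp n) gcdn ((val u : 'Z_n) - 1) n ^ r.
Proof.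
move=> n_gt0; have [n1|n_gt1] := leqP n 1.
  have {n_gt0 n1} -> : n = 1 by apply/eqP; rewrite eqn_leq n1.
  rewrite unit_gcd_sum1 (eq_bigr (fun=> 1)) => [|u _]; last first.
    by rewrite gcdn1 exp1n.
  by rewrite sum1_card card_units_Zp.
transitivity (\sum_(x : 'Z_n | x \is a GRing.unit) gcdn (x - 1) n ^ r).
  by case: n n_gt1 {n_gt0} => [|[|n']] // _; apply: eq_bigl => x.
rewrite (reindex_omap (val : {unit 'Z_n} -> 'Z_n) insub) => [|x Ux].
  by apply: eq_bigl => u; rewrite valK eqxx (valP u) inE.
by rewrite insubT.
Qed.

(** The ranges 0, ..., q - 1 and 1, ..., q, for q = p^a, differ only in 0 and q,
both divisible by p. *)
Lemma unit_gcd_sum_pfactor r p a : prime p -> 0 < a ->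
  unit_gcd_sum r (p ^ a) =
    \sum_(1 <= m < (p ^ a).+1 | ~~ (p %| m)) gcdn (m - 1) (p ^ a) ^ r.
Proof.
move=> p_pr a_gt0; have q_gt0 : 0 < p ^ a by rewrite expn_gt0 prime_gt0.
have co_q m : coprime (p ^ a) m = ~~ (p %| m).
  by rewrite coprime_pexpl // prime_coprime.
pose F m := if ~~ (p %| m) then gcdn (m - 1) (p ^ a) ^ r else 0.
rewrite /unit_gcd_sum (eq_bigl _ _ (fun m : 'I__ => co_q m)).
rewrite big_mkcond [RHS]big_mkcond /=.
rewrite -(big_mkord xpredT F) [RHS]big_nat_recr //= [LHS]big_ltn //.
by rewrite /F dvdn0 dvdn_exp // addn0.
Qed.

Local Open Scope ring_scope.

Theorem corollary3 (n : nat) (n_gt0 : (0 < n)%N)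
    (k : nat) (p alpha : 'I_k -> nat)
    (p_inj : injective p)
    (p_prime : forall i, prime (p i))
    (alpha_gt0 : forall i, (0 < alpha i)%N)
    (n_decomp : n = (\prod_(i < k) p i ^ alpha i)%N)
    (r : nat) (r_gt0 : (0 < r)%N) :
  (#|cyclic_subgroups (Zn_power n r)|%:R : rat) =
  (totient n)%:R^-1 *
    \prod_(i < k)
      \sum_(1 <= m < (p i ^ alpha i).+1 | ~~ (p i %| m)%N)
        (gcdn (m - 1) (p i ^ alpha i))%:R ^+ r.
Proof.
have expG := exponent_Zn_power r n_gt0.
have burnside : (#|cyclic_subgroups (Zn_power n r)| * totient n)%N =
                (\prod_(i < k) unit_gcd_sum r (p i ^ alpha i))%N.
  rewrite -unit_gcd_sum_prod -?n_decomp => [|i|i j neq_ij].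
  - rewrite -(sum_fixed_powers n_gt0 expG) unit_gcd_sum_units //.
    apply: eq_bigr => u _; rewrite card_fixed_powers //.
    have := valP u; rewrite unfold_in /=.
    by case: (posnP (val u : 'Z_n)) => // ->; rewrite /coprime gcdn0.
  - by rewrite expn_gt0 prime_gt0.
  rewrite coprime_pexpl // coprime_pexpr // prime_coprime // dvdn_prime2 //.
  by rewrite (inj_eq p_inj).
rewrite GRing.mulrC; apply: (canRL (GRing.mulfK _)).
  by rewrite Num.Theory.pnatr_eq0 -lt0n totient_gt0.
rewrite -GRing.natrM burnside GRing.natr_prod; apply: eq_bigr => i _.
rewrite unit_gcd_sum_pfactor // GRing.natr_sum.
by apply: eq_bigr => m _; rewrite GRing.natrX.
Qed.
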